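(* There exists a positive real $r_0$ such that the following holds for every positive integer $r$ and positive real $\alpha\le1$ with $(\log r)^\alpha\ge r_0$. For $n=2^{(\log r)^{2+\alpha}/200}$, there exists a partition $E=E_1\cup\dots\cup E_{\sqrt r}$ of the edge set of the complete graph $K_n$ such that \[ \chi(\mathcal{G}_I)\le 2^{3(\log r)^{\alpha/2}\sqrt{|I|\log 2|I|}} \] for all $I\subseteq[\sqrt r]$.
   Context: Logarithms are base 2; non-integer quantities such as $n$ and $\sqrt r$ are understood rounded to integers (the paper omits floor and ceiling signs), and some parts $E_i$ may be empty. For $I\subseteq[\sqrt r]$, $\mathcal{G}_I$ is the spanning subgraph of $K_n$ with edge set $\bigcup_{i\in I}E_i$; $\chi$ is chromatic number. *)

(* Defs.v *)
From Stdlib Require Import Reals.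
From mathcomp Require Import all_boot.
Set Implicit Arguments. Unset Strict Implicit. Unset Printing Implicit Defensive.

Definition log2 (x : R) : R := Rdiv (ln x) (ln 2).

(* Real power x^y for x >= 0, with the convention 0^y = 0 (used for y > 0). *)
Definition powr (x y : R) : R := if Rle_dec x 0 then R0 else Rpower x y.

Definition floor_nat (x : R) : nat := Z.to_nat (Int_part x).

Definition colorable (V : finType) (e : rel V) (k : nat) : bool :=
  [exists f : {ffun V -> 'I_k},
     [forall u : V, forall v : V, ((u != v) && e u v) ==> (f u != f v)]].

Lemma colorable_card (V : finType) (e : rel V) : colorable e #|V|.
Proof.
apply/existsP; exists [ffun x => enum_rank x].
apply/forallP => u; apply/forallP => v; apply/implyP => /andP [uv _].
rewrite !ffunE; apply: contra uv => /eqP h.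
by apply/eqP; apply: enum_rank_inj.
Qed.

Lemma ex_colorable (V : finType) (e : rel V) : exists k, colorable e k.
Proof. by exists #|V|; apply: colorable_card. Qed.

Definition chromatic_number (V : finType) (e : rel V) : nat :=
  ex_minn (ex_colorable e).

(* An edge partition of K_n into m parts E_0,...,E_{m-1} is encoded by a
   symmetric map c : 'I_n -> 'I_n -> 'I_m : the edge {u,v} (u <> v) lies in
   part c u v.  G_I is the spanning subgraph with edges in parts of I. *)
Definition subgraph_of_parts (n m : nat) (c : 'I_n -> 'I_n -> 'I_m)
  (I : {set 'I_m}) : rel 'I_n :=
  fun u v => (u != v) && (c u v \in I).

(* Main.v *)
(** Write [L = log r] and identify the vertices with words made of about [L^alpha]
    blocks, each consisting of about [L/10] symbols from an alphabet of size
    about [2^(L/10)].  The colour of [xy] records the first block [p] where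
    [x] and [y] differ, the first position [i] of difference in that block, the
    set [D] of all positions of difference in that block, and one of the two
    symbols [x_(p,i)], [y_(p,i)].

    Let [I] be a set of colours and [s = |I|].  If, for some colour [K] with position
    [(p,i)] and symbol [a], more than [B] colours of [I] have block [p] and [i] in
    [D], split the vertices according to whether [x_(p,i) = a]: one side sees none
    of these colours, the other does not see [K].  If there is no such [K], the
    colours can be greedily put into [B] classes so that, for each edge of colour
    [K], every other colour of the class and block of [K] has its symbol at its
    position either in both endpoints or in neither.  Hence the parities, for
    all blocks and classes, of the number of colours whose symbol occurs at their
    position in the vertex give a proper colouring with [2^(T B)] values, where
    [T] is the number of blocks.
    This yields [chi <= 2^(T B) lam^s] as soon as
    [lam^B + 1 <= lam^(B+1)], and [B ~ sqrt(s log(2s) / T)],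
    [lam = 2^(2 sqrt(T log(2s) / s))] give the bound. *)
Require Import Defs.
From Stdlib Require Import ZArith Reals Lra Lia.
From mathcomp Require Import all_boot zify.
Set Implicit Arguments. Unset Strict Implicit. Unset Printing Implicit Defensive.
Delimit Scope R_scope with R.

Lemma INR_expn a b : INR (a ^ b)%N = (INR a ^ b)%R.
Proof. by elim: b => //= b IHb; rewrite expnS -multE mult_INR IHb. Qed.

(** * Proper colourings and greedy classes *)

Section Colorability.

Variable V : finType.
Implicit Type e : rel V.

Lemma colorableP e k :
  reflect (exists f : V -> 'I_k, forall u v, u != v -> e u v -> f u != f v)
          (colorable e k).
Proof.
apply: (iffP existsP) => [[f /forallP fP]|[f fP]].
  by exists f => u v uv euv; move/forallP/(_ v)/implyP: (fP u); rewrite uv euv; apply.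
exists [ffun x => f x]; apply/forallP => u; apply/forallP => v.
by apply/implyP => /andP[uv euv]; rewrite !ffunE; apply: fP.
Qed.

Lemma colorable_fin (S : finType) (f : V -> S) e :
  (forall u v, u != v -> e u v -> f u != f v) -> colorable e #|S|.
Proof.
move=> fP; apply/colorableP; exists (fun u => enum_rank (f u)) => u v uv euv.
by rewrite (inj_eq enum_rank_inj); apply: fP.
Qed.

(** The two sides get disjoint palettes, which takes care of all edges between them. *)
Lemma colorable_split (P : pred V) e e1 e2 q1 q2 :
  colorable e1 q1 -> colorable e2 q2 ->
  (forall u v, P u -> P v -> u != v -> e u v -> e1 u v) ->
  (forall u v, ~~ P u -> ~~ P v -> u != v -> e u v -> e2 u v) ->
  colorable e (q1 + q2).
Proof.
move=> /colorableP[f1 f1P] /colorableP[f2 f2P] e1P e2P.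
apply/colorableP.
exists (fun u => if P u then lshift q2 (f1 u) else rshift q1 (f2 u)) => u v uv euv.
case: ifP => Pu; case: ifP => Pv.
- by rewrite (inj_eq (@lshift_inj _ _)); apply: f1P => //; apply: e1P.
- by rewrite eq_lrshift.
- by rewrite eq_rlshift.
- by rewrite (inj_eq (@rshift_inj _ _)); apply: f2P => //; apply: e2P; rewrite ?Pu ?Pv.
Qed.

Lemma chromatic_number_le e k : colorable e k -> chromatic_number e <= k.
Proof. by move=> ek; rewrite /chromatic_number; case: ex_minnP => j _; apply. Qed.

End Colorability.

Lemma colorable_preim (U V : finType) (h : U -> V) (eU : rel U) (eV : rel V) k :
  injective h -> (forall u v, u != v -> eU u v -> eV (h u) (h v)) ->
  colorable eV k -> colorable eU k.
Proof.
move=> h_inj hP /colorableP[f fP]; apply/colorableP; exists (f \o h) => u v uv euv.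
by apply: fP; rewrite ?(inj_eq h_inj) ?hP.
Qed.

(* A vertex of maximal rank has at most [B - 1] conflicting neighbours, so
   vertices are treated by increasing rank. *)
Lemma greedy_classes (C : finType) (conf : rel C) (rank : C -> nat) (B : nat)
    (I : {set C}) :
  {in I, forall a, conf a a} ->
  {in I &, forall a b, conf a b -> rank a <= rank b} ->
  {in I &, forall a b, rank a = rank b -> conf a b -> conf b a} ->
  {in I, forall b, #|[set a in I | conf a b]| <= B} ->
  exists g : C -> nat, {in I, forall a, g a < B} /\
    {in I &, forall a b, a != b -> conf a b -> g a != g b}.
Proof.
move: {2}#|I| (erefl #|I|) => s; elim: s I => [|s IHs] I sI refl mono sym degB.
  have I0 : I = set0 by apply/cards0_eq.
  by exists (fun=> 0); split=> a; rewrite I0 inE.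
have /card_gt0P[z0 z0I] : 0 < #|I| by rewrite sI.
have [z zI zmax] : exists2 z, z \in I & forall a, a \in I -> rank a <= rank z.
  by case: (arg_maxnP rank z0I) => z; exists z.
have subI a : a \in I :\ z -> a \in I by case/setD1P.
have [|a /subI|a b /subI aI /subI|a b /subI aI /subI|b /subI bI|g [gB gP]] := IHs (I :\ z).
- by move: sI; rewrite (cardsD1 z) zI => -[].
- exact: refl.
- exact: mono.
- exact: sym.
- apply: leq_trans (degB b bI); apply: subset_leq_card.
  by apply/subsetP => a; rewrite !inE => /andP[/andP[_ ->]].
pose U := [set a in I :\ z | conf a z].
(* Since [conf z z], the set bounded by [degB] also contains [z], so its other elements leave a
   class free. *)
have ltUB : #|U| < B.
  apply: leq_trans (degB z zI); apply: proper_card; apply/properP; split.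
    by apply/subsetP => a; rewrite !inE => /andP[/andP[_ ->]].
  by exists z; rewrite !inE ?zI ?refl ?eqxx.
have [w wP] : exists w : 'I_B, nat_of_ord w \notin [seq g a | a in U].
  apply/existsP; apply: contraLR ltUB; rewrite negb_exists -leqNgt => /forallP nw.
  rewrite -(size_image g) -{1}(size_enum_ord B) -(size_map val).
  apply: uniq_leq_size; first by rewrite map_inj_uniq ?enum_uniq //; apply: val_inj.
  by move=> i /mapP[j _ ->]; move: (nw j); rewrite negbK.
have wU a : a \in I -> a != z -> conf a z -> g a != w.
  move=> aI az caz; apply: contra wP => /eqP <-; apply: image_f.
  by rewrite !inE az aI.
exists (fun a => if a == z then nat_of_ord w else g a); split=> [a aI|a b aI bI ab cab].
  by case: (eqVneq a z) => // az; apply: gB; rewrite !inE az.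
case: (eqVneq a z) => az; case: (eqVneq b z) => bz.
- by rewrite az bz eqxx in ab.
(* Here [conf z b] and the maximality of [z] force equal ranks, so the conflict can be reversed. *)
- rewrite eq_sym; apply: wU => //; rewrite -az; apply: sym => //.
  by apply/eqP; rewrite eqn_leq mono //= az; apply: zmax.
- by apply: wU => //; rewrite -bz.
- by apply: gP; rewrite // !inE ?az ?bz.
Qed.

(** * First differences of words *)

Section FirstDiff.

Variables (N : nat) (S : eqType).
Implicit Types x y : {ffun 'I_N.+1 -> S}.

Definition first_diff x y : 'I_N.+1 :=
  odflt ord0 [pick p | (x p != y p) && [forall q : 'I_N.+1, (q < p) ==> (x q == y q)]].

Lemma first_diffC x y : first_diff x y = first_diff y x.
Proof.
rewrite /first_diff; congr odflt; apply: eq_pick => p.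
by rewrite eq_sym; congr (_ && _); apply: eq_forallb => q; rewrite [y q == _]eq_sym.
Qed.

Lemma first_diffP x y : x != y ->
  x (first_diff x y) != y (first_diff x y) /\
  forall q : 'I_N.+1, q < first_diff x y -> x q = y q.
Proof.
move=> xy; rewrite /first_diff; case: pickP => [p /andP[pP /forallP qP]|no].
  by split=> // q qp; apply/eqP; move/implyP: (qP q); apply.
have [q0 q0P] : exists q, x q != y q.
  apply/existsP; apply: contraR xy; rewrite negb_exists => /forallP xy.
  by apply/eqP/ffunP => q; apply/eqP; move: (xy q); rewrite negbK.
case: (@arg_minnP _ q0 (fun q => x q != y q) val q0P) => p pP pmin.
have /negP[] := no p; rewrite pP; apply/forallP => q; apply/implyP => qp.
by apply: contraTT qp => /pmin; rewrite -leqNgt.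
Qed.

End FirstDiff.

(** * The colouring of block words and its subgraphs *)

Section BlockColouring.

Variables T t k : nat.

Definition block_vertex : finType := {ffun 'I_T.+1 -> {ffun 'I_t.+1 -> 'I_k}}.
Definition block_colour : finType :=
  ('I_T.+1 * 'I_t.+1 * ({set 'I_t.+1} * 'I_k))%type.

Implicit Types (x y : block_vertex) (K : block_colour) (I : {set block_colour}).

Definition blk K := K.1.1.
Definition piv K := K.1.2.
Definition diffs K := K.2.1.
Definition sym K := K.2.2.

(* [sym] is the smaller of the two symbols only to make the colouring symmetric:
   all that matters is that exactly one endpoint carries it. *)
Definition colour x y : block_colour :=
  let p := first_diff x y in
  let i := first_diff (x p) (y p) in
  (p, i, ([set j | x p j != y p j],
          if x p i < y p i then x p i else y p i)).

Lemma colourC x y : colour x y = colour y x.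
Proof.
rewrite /colour (first_diffC y x); set p := first_diff x y.
rewrite (first_diffC (y p)); set i := first_diff _ _.
congr (_, (_, _)); first by apply/setP => j; rewrite !inE eq_sym.
by case: ltngtP => // /val_inj.
Qed.

(** Satisfied by every colour occurring on an edge. Minimality of [piv K] makes positions
    nondecreasing along conflicts, which gives the rank for [greedy_classes]. *)
Definition valid K :=
  (piv K \in diffs K) && [forall (j : 'I_t.+1 | j \in diffs K), piv K <= j].

Definition marked x K := x (blk K) (piv K) == sym K.

Lemma colour_blk x y j :
  (j \in diffs (colour x y)) =
  (x (blk (colour x y)) j != y (blk (colour x y)) j).
Proof. by rewrite inE. Qed.

Lemma colour_valid x y : x != y -> valid (colour x y).
Proof.
move=> /first_diffP[/first_diffP[pP pmin] _]; rewrite /valid inE pP /=.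
apply/forallP => j; apply/implyP; rewrite inE => jP.
by rewrite leqNgt; apply: contra jP => /pmin ->.
Qed.

Lemma colour_marked x y : x != y ->
  marked x (colour x y) != marked y (colour x y).
Proof.
move=> /first_diffP[/first_diffP[+ _] _]; rewrite /marked /blk /piv /sym /=.
set p := first_diff x y; set i := first_diff _ _ => xyi.
case: ifP => _; first by rewrite eqxx [y p i == _]eq_sym (negbTE xyi).
by rewrite eqxx (negbTE xyi).
Qed.

Definition colour_graph I : rel block_vertex := fun x y => colour x y \in I.

(** A directed relation: along an edge of colour [K], the mark of a [K'] with the same block can
    change only if [piv K'] is a position of difference. *)
Definition conflict K K' := (blk K == blk K') && (piv K' \in diffs K).

Lemma conflict_marked x y K' : x != y -> blk (colour x y) = blk K' ->
  ~~ conflict (colour x y) K' -> marked x K' = marked y K'.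
Proof.
move=> xy bK; rewrite /conflict bK eqxx colour_blk bK negbK /= /marked.
by move=> /eqP->.
Qed.

Lemma colorable_parity I B :
  {in I, forall K, valid K} ->
  {in I, forall K', #|[set K in I | conflict K K']| <= B} ->
  colorable (colour_graph I) (2 ^ (T.+1 * B)).
Proof.
move=> Iv degB.
have [|K K' KI K'I|K K' KI K'I|//|g [gB gP]] :=
  @greedy_classes _ conflict (fun K => piv K) B I.
- by move=> K /Iv/andP[KD _]; rewrite /conflict eqxx KD.
- move=> /andP[_ KD]; case/andP: (Iv K KI) => _ /forallP/(_ (piv K')).
  by rewrite KD.
- move=> /val_inj eqp /andP[/eqP eqb _]; rewrite /conflict eqb eqxx eqp.
  by case/andP: (Iv K' K'I).
pose f x := [ffun pb : 'I_T.+1 * 'I_B =>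
  \big[addb/false]_(K in I | (blk K == pb.1) && (g K == pb.2)) marked x K].
have -> : 2 ^ (T.+1 * B) = #|{ffun 'I_T.+1 * 'I_B -> bool}|.
  by rewrite card_ffun card_bool card_prod !card_ord.
apply: (@colorable_fin _ _ f) => x y xy xyI.
set K := colour x y; have KI : K \in I := xyI.
(* At the coordinate given by the block and class of [K], the term of [K] changes along the edge and
   all others agree, so the parities differ. *)
apply/eqP => /ffunP/(_ (blk K, Ordinal (gB K KI))); rewrite !ffunE /=.
have KP : [&& K \in I, blk K == blk K & g K == g K] by rewrite KI !eqxx.
rewrite (bigD1 K KP) [RHS](bigD1 K KP) /=.
under eq_bigr => K' /andP[/and3P[K'I /eqP bK' /eqP gK'] K'K].
  rewrite (@conflict_marked x y) //; last first.
    apply: contraTN (eqxx (g K)) => /(gP _ _ KI K'I); rewrite eq_sym => /(_ K'K).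
    by rewrite gK'.
  over.
move/addIb => eqm; have := colour_marked xy.
by rewrite eqm eqxx.
Qed.

(** Two marked endpoints agree at the position of [K], so their colour is not in conflict with [K];
    an edge of colour [K] has exactly one marked endpoint. *)
Lemma colorable_branch I K q1 q2 :
  colorable (colour_graph (I :\: [set K' in I | conflict K' K])) q1 ->
  colorable (colour_graph (I :\ K)) q2 ->
  colorable (colour_graph I) (q1 + q2).
Proof.
move=> c1 c2; apply: (@colorable_split _ (fun x => marked x K) _ _ _ _ _ c1 c2).
  move=> x y xK yK xy; rewrite /colour_graph => xyI; rewrite !inE xyI andbT /=.
  apply: contraTN (xyI) => /andP[/eqP bK]; rewrite colour_blk bK.
  by rewrite (eqP xK) (eqP yK) eqxx.
move=> x y xK yK xy; rewrite /colour_graph => xyI; rewrite !inE xyI andbT.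
by apply: contraTneq (colour_marked xy) => ->; rewrite (negbTE xK) (negbTE yK).
Qed.

Lemma colour_graph_valid I q :
  colorable (colour_graph [set K in I | valid K]) q -> colorable (colour_graph I) q.
Proof.
apply: (@colorable_preim _ _ id) => // x y xy xyI.
by rewrite /colour_graph inE colour_valid // andbT.
Qed.

Lemma colorable_bound (lam : R) (B : nat) I :
  (1 <= lam)%R -> (lam ^ B + 1 <= lam ^ B.+1)%R ->
  exists q, colorable (colour_graph I) q /\
    (INR q <= 2 ^ (T.+1 * B)%N * lam ^ #|I|)%R.
Proof.
move=> lam1 lamB; pose M := (2 ^ (T.+1 * B)%N)%R.
have M0 : (0 < M)%R by apply: pow_lt; lra.
(* An upper bound [s] replaces the cardinal because a branch may lose more than [B.+1] colours. *)
suff main s (J : {set block_colour}) : #|J| <= s -> {in J, forall K, valid K} ->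
    exists q, colorable (colour_graph J) q /\ (INR q <= M * lam ^ s)%R.
  have [//|K|q [cq leq]] := main #|I| [set K in I | valid K].
  - by apply: subset_leq_card; apply/subsetP => K; rewrite inE => /andP[].
  - by rewrite inE => /andP[].
  by exists q; split=> //; apply: colour_graph_valid.
elim/ltn_ind: s J => s IHs J Js Jv.
have lam_pos n : (1 <= lam ^ n)%R by apply: pow_R1_Rle.
have [/'exists_andP[K [KJ BK]]|] :=
  boolP [exists K, (K \in J) && (B < #|[set K' in J | conflict K' K]|)].
  set L := [set _ in J | _] in BK.
  have LJ : L \subset J by apply/subsetP => K'; rewrite inE => /andP[].
  have sL : B < s.
    by apply: leq_trans BK (leq_trans _ Js); apply: subset_leq_card.
  have [||K' |q1 [c1 q1P]] := IHs (s - B.+1) _ (J :\: L).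
  - by rewrite ltn_subrL; case: s sL {IHs Js}.
  - by rewrite cardsD (setIidPr LJ); apply: leq_sub.
  - by case/setDP => /Jv.
  have [||K' |q2 [c2 q2P]] := IHs s.-1 _ (J :\ K).
  - by case: s sL {IHs Js q1P}.
  - by case: s sL Js {IHs q1P} => // s _; rewrite (cardsD1 K J) KJ.
  - by case/setD1P => _ /Jv.
  exists (q1 + q2); split; first exact: (@colorable_branch _ K).
  rewrite -plusE plus_INR.
  apply: Rle_trans (Rplus_le_compat _ _ _ _ q1P q2P) _.
  rewrite -Rmult_plus_distr_l; apply: Rmult_le_compat_l; first lra.
  (* The branches add up to [lam ^ (s - B.+1) * (1 + lam ^ B)], at most [lam ^ s]. *)
  have -> : s.-1 = (s - B.+1) + B.
    by case: s sL {IHs Js q1P q2P} => // s sL; rewrite subSS subnK.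
  rewrite -{3}(subnK sL) -!plusE !pow_add.
  rewrite -{1}[(lam ^ _)%R]Rmult_1_r -Rmult_plus_distr_l Rplus_comm.
  by apply: Rmult_le_compat_l => //; have := lam_pos (s - B.+1); lra.
rewrite negb_exists => /forallP noK.
exists (2 ^ (T.+1 * B)); split.
  apply: colorable_parity => // K KJ; move: (noK K); rewrite KJ /=.
  by rewrite -leqNgt.
rewrite INR_expn; have := lam_pos s; change (INR 2) with 2%R; rewrite -/M; nra.
Qed.

End BlockColouring.

(** * Transfer to the complete graph *)

Lemma good_partition (T t k n m : nat) :
  n <= (k ^ t.+1) ^ T.+1 -> T.+1 * t.+1 * (2 ^ t.+1 * k) <= m ->
  exists c : 'I_n -> 'I_n -> 'I_m, (forall u v, c u v = c v u) /\
    forall (I : {set 'I_m}) (lam : R) (B : nat),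
    (1 <= lam)%R -> (lam ^ B + 1 <= lam ^ B.+1)%R ->
    (INR (chromatic_number (subgraph_of_parts c I)) <=
       2 ^ (T.+1 * B)%N * lam ^ #|I|)%R.
Proof.
move=> nV mC.
have nV' : n <= #|block_vertex T t k| by rewrite !card_ffun !card_ord.
have mC' : #|block_colour T t k| <= m.
  have card_setI : #|{set 'I_t.+1}| = 2 ^ t.+1.
    by rewrite -[LHS]cardsT -powersetT card_powerset cardsT card_ord.
  by rewrite !card_prod card_setI !card_ord.
pose h (u : 'I_n) := enum_val (widen_ord nV' u).
have h_inj : injective h by move=> u v /enum_val_inj/(congr1 val)/= /val_inj.
pose g K := widen_ord mC' (enum_rank K).
have g_inj : injective g by move=> K K' /(congr1 val)/= /val_inj/enum_rank_inj.
exists (fun u v => g (colour (h u) (h v))); split=> [u v|I lam B lam1 lamB].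
  by rewrite colourC.
pose J := g @^-1: I.
have [q [cq qP]] := colorable_bound J lam1 lamB.
have cq' : colorable (subgraph_of_parts (fun u v => g (colour (h u) (h v))) I) q.
  apply: colorable_preim h_inj _ cq => u v uv /andP[_ uvI].
  by rewrite /colour_graph inE.
apply: Rle_trans (le_INR _ _ _) (Rle_trans _ _ _ qP _).
  by apply/leP; apply: chromatic_number_le cq'.
apply: Rmult_le_compat_l; first by apply: pow_le; lra.
(* Members of [I] outside the image of [g] have no counterpart in [J], hence an inequality of
   cardinals. *)
apply: Rle_pow => //; apply/leP.
rewrite -(card_imset _ g_inj); apply: subset_leq_card.
by apply/subsetP => _ /imsetP[K KJ ->]; rewrite inE in KJ.
Qed.

(** * Real estimates and choice of parameters *)

Open Scope R_scope.

Lemma floor_natP x : 0 <= x -> INR (floor_nat x) <= x < INR (floor_nat x) + 1.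
Proof.
move=> x0; have [le1 gt1] := base_Int_part x.
have z0 : (0 <= Int_part x)%Z.
  by have : IZR (-1) < IZR (Int_part x) by [lra|] => /lt_IZR; lia.
by rewrite /floor_nat INR_IZR_INZ Z2Nat.id //; lra.
Qed.

Lemma Rpower2_log2 x : 0 < x -> Rpower 2 (log2 x) = x.
Proof.
move=> x0; rewrite /Rpower /log2; have := ln_lt_2 => ln2.
have -> : ln x / ln 2 * ln 2 = ln x by field; lra.
exact: exp_ln.
Qed.

Lemma Rpower2_INR n : Rpower 2 (INR n) = 2 ^ n.
Proof. by apply: Rpower_pow; lra. Qed.

Lemma log2_ge1 x : 2 <= x -> 1 <= log2 x.
Proof.
move=> x2; have ln2 := ln_lt_2; rewrite /log2.
apply: (Rmult_le_reg_r (ln 2)); first lra.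
have -> : ln x / ln 2 * ln 2 = ln x by field; lra.
by case: x2 => [x2|<-]; [have := ln_increasing 2 x; lra|lra].
Qed.

Lemma Rpower2_ge x : 0 <= x -> 1 + x / 2 <= Rpower 2 x.
Proof.
move=> x0; rewrite /Rpower; have ln2 := ln_lt_2.
have := exp_ineq1_le (x * ln 2); nra.
Qed.

(** With [Y = sqrt (T * s * l)], the factor [2 ^ (T * B)] is at most [2 ^ Y] and [lam ^ s] is
    [2 ^ (2 * Y)]; hence the constant 3. *)
Lemma branching_parameters (T s : nat) : (0 < T)%N -> (0 < s)%N ->
  exists (lam : R) (B : nat), 1 <= lam /\ lam ^ B + 1 <= lam ^ B.+1 /\
    2 ^ (T * B)%N * lam ^ s <=
      Rpower 2 (3 * sqrt (INR T) * sqrt (INR s * log2 (2 * INR s))).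
Proof.
move=> /leP/le_INR T1 /leP/le_INR s1; rewrite /= in T1 s1.
have l1 : 1 <= log2 (2 * INR s) by apply: log2_ge1; lra.
set l := log2 _ in l1 *.
pose Y := sqrt (INR T) * sqrt (INR s * l).
have YY : Y * Y = INR T * (INR s * l).
  have -> : Y * Y = (sqrt (INR T) * sqrt (INR T)) *
                    (sqrt (INR s * l) * sqrt (INR s * l)) by rewrite /Y; ring.
  by rewrite !sqrt_sqrt //; nra.
have Y0 : 0 <= Y by apply: Rmult_le_pos; apply: sqrt_pos.
have sl1 : 1 <= INR s * l by nra.
have YY1 : 1 <= Y * Y by rewrite YY; nra.
have Y1 : 1 <= Y by clear YY; nra.
have w0 : 0 <= Y / INR T by apply: Rmult_le_pos => //; apply/Rlt_le/Rinv_0_lt_compat; lra.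
pose th := 2 * Y / INR s.
have ths : th * INR s = 2 * Y by rewrite /th; field; lra.
have th0 : 0 <= th by nra.
pose B := floor_nat (Y / INR T); have [Bw wB] := floor_natP w0.
rewrite -/B in Bw wB.
have TB : INR T * INR B <= Y.
  have -> : Y = INR T * (Y / INR T) by field; lra.
  by apply: Rmult_le_compat_l; lra.
(* Although [B] is rounded down, [B.+1] exceeds [Y / T]; this yields [lam ^ B.+1 >= (2 * s) ^ 2]. *)
have thB : 2 * l <= th * INR B.+1.
  have -> : 2 * l = th * (Y / INR T).
    have -> : th * (Y / INR T) = 2 * (Y * Y) / (INR s * INR T) by rewrite /th; field; lra.
    by rewrite YY; field; lra.
  by rewrite S_INR; apply: Rmult_le_compat_l; lra.
have powE n : Rpower 2 th ^ n = Rpower 2 (th * INR n).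
  by rewrite -Rpower_pow ?Rpower_mult //; apply: exp_pos.
have lam_ge := Rpower2_ge th0.
exists (Rpower 2 th), B; split; first lra; split.
  have Xge : 4 * (INR s * INR s) <= Rpower 2 th ^ B.+1.
    have -> : 4 * (INR s * INR s) = Rpower 2 (2 * l).
      have -> : 2 * l = l + l by ring.
      by rewrite Rpower_plus /l Rpower2_log2; [ring|lra].
    by rewrite powE; apply: Rle_Rpower; lra.
  move: Xge => /=; set X := _ ^ B; set lam := Rpower 2 th in lam_ge * => Xge.
  have X0 : 0 < X by apply: pow_lt; apply: exp_pos.
  (* This is [lam - 1 >= Y / s >= 1 / s]. Below, with [e = lam * s - s >= 1], all reduces to
     [s + e <= 4 * s * s * e]. *)
  have lams : INR s + 1 <= lam * INR s by nra.
  have : 1 * (lam * INR s) <= (X * (lam - 1)) * (lam * INR s).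
    have -> : X * (lam - 1) * (lam * INR s) = (lam * X) * (lam * INR s - INR s) by ring.
    set e := lam * INR s - INR s; have -> : lam * INR s = INR s + e by rewrite /e; ring.
    have e1 : 1 <= e by rewrite /e; lra.
    have se1 : 0 <= (INR s - 1) * (e - 1) by apply: Rmult_le_pos; lra.
    have : INR s + e <= 4 * (INR s * INR s) * e.
      have : 0 <= INR s * e * (INR s - 1) by repeat apply: Rmult_le_pos; lra.
      lra.
    have := Rmult_le_compat_r e _ _ _ Xge; lra.
  move=> h; have : 1 <= X * (lam - 1) by apply: Rmult_le_reg_r h; nra.
  lra.
rewrite powE -Rpower2_INR -Rpower_plus; apply: Rle_Rpower; first lra.
rewrite -multE mult_INR ths Rmult_assoc -/Y; lra.
Qed.

(** Serves to count colours: [10 * t.+1] will bound the number of blocks, and [t <= L / 10] gives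
    [2 ^ (5 * t) <= sqrt r]. An induction step multiplies the left side by less than 8 and the right
    side by 32. *)
Lemma exponential_margin t : (5 <= t)%N ->
  (10 * t.+1 * t.+1 * (2 ^ t.+1 * 2 ^ t.+1) <= 2 ^ (5 * t))%N.
Proof.
elim: t => // t IHt; rewrite leq_eqVlt => /predU1P[<-|/IHt].
  have -> : (2 ^ (5 * 5) = 2 ^ 13 * (2 ^ 6 * 2 ^ 6))%N by rewrite -!expnD.
  by rewrite leq_mul2r.
rewrite [(5 * t.+1)%N]mulnS [(2 ^ (5 + _))%N]expnD ![(2 ^ t.+2)%N]expnS.
move: (2 ^ (5 * t))%N (2 ^ t.+1)%N => a b h.
nia.
Qed.

(** * The partition for given [r] and [alpha] *)

Theorem theorem3p3 :
  exists r0 : R, 0 < r0 /\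
  forall (r : nat) (alpha : R),
    (0 < r)%N -> 0 < alpha <= 1 ->
    r0 <= powr (log2 (INR r)) alpha ->
    let n := floor_nat (Rpower 2 (powr (log2 (INR r)) (2 + alpha) / 200)) in
    let m := floor_nat (sqrt (INR r)) in
    exists c : 'I_n -> 'I_n -> 'I_m,
      (forall u v : 'I_n, c u v = c v u) /\
      forall I : {set 'I_m},
        INR (chromatic_number (subgraph_of_parts c I)) <=
        Rpower 2 (3 * powr (log2 (INR r)) (alpha / 2)
                    * sqrt (INR #|I| * log2 (2 * INR #|I|))).
Proof.
(* As [alpha <= 1], this forces [L >= A >= 60], hence [t >= 5] for [exponential_margin]. *)
exists 60; split; first lra.
move=> r al /ltP/lt_INR r0 [al0 al1]; set L := log2 _ => LA n m.
have L0 : 0 < L.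
  apply: Rnot_le_lt => L0; move: LA.
  by rewrite /powr; case: Rle_dec => //= h; change R0 with 0; lra.
have powrE y : powr L y = Rpower L y.
  by rewrite /powr; case: (Rle_dec L 0) => // ?; lra.
rewrite {}/n !powrE in LA *; set n := floor_nat _; set A := Rpower L al in LA.
have L1 : 1 < L.
  case: (Rlt_le_dec 1 L) => // L1; suff : A <= Rpower 1 al.
    by rewrite /Rpower ln_1 Rmult_0_r exp_0; lra.
  by apply: Rle_Rpower_l; lra.
have AL : A <= L by rewrite -[X in _ <= X]Rpower_1 //; apply: Rle_Rpower; lra.
have [TA AT] : INR (floor_nat A) <= A < INR (floor_nat A) + 1 by apply: floor_natP; lra.
(* The number [T.+1] of blocks is rounded down, since the final bound uses [sqrt T.+1 <= sqrt A];
   the block length [t.+1] exceeds [L / 10]. *)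
case: (floor_nat A) TA AT => [|T] TA AT; first by move: AT => /=; lra.
have [tL Lt] : INR (floor_nat (L / 10)) <= L / 10 < INR (floor_nat (L / 10)) + 1.
  by apply: floor_natP; lra.
set t := floor_nat _ in tL Lt.
have t5 : (5 <= t)%N by apply/leP/INR_le => /=; lra.
have sqrtE : sqrt (INR r) = Rpower 2 (L / 2).
  by rewrite -[L / 2]/(L * / 2) -Rpower_mult Rpower2_log2 // Rpower_sqrt.
have sqrtA : Rpower L (al / 2) = sqrt A.
  by rewrite -[al / 2]/(al * / 2) -Rpower_mult Rpower_sqrt //; apply: exp_pos.
have Lpow : Rpower L (2 + al) = L * L * A.
  by rewrite Rpower_plus -[2]/(INR 2) Rpower_pow //= Rmult_1_r.
have pos x : 0 <= Rpower 2 x by apply/Rlt_le/exp_pos.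
have [nle _] := floor_natP (pos (Rpower L (2 + al) / 200)); rewrite -/n in nle.
have [_ ltm] := floor_natP (sqrt_pos (INR r)); rewrite -/m sqrtE in ltm.
have nV : (n <= ((2 ^ t.+1) ^ t.+1) ^ T.+1)%N.
  apply/leP/INR_le/(Rle_trans _ _ _ nle).
  rewrite -!expnM INR_expn [INR 2]/2 -Rpower2_INR; apply: Rle_Rpower; first lra.
  rewrite -!multE !mult_INR Lpow [INR t.+1]S_INR -[X in _ <= X]Rmult_assoc.
  (* In [200 = 10 * 10 * 2] the factor 2 pays for rounding [A] down. *)
  have -> : L * L * A / 200 = L / 10 * (L / 10) * (A / 2) by field.
  apply: Rmult_le_compat; [nra|lra| |lra].
  by apply: Rmult_le_compat; lra.
have mC : (T.+1 * t.+1 * (2 ^ t.+1 * 2 ^ t.+1) <= m)%N.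
  apply: leq_trans (leq_trans _ (exponential_margin t5)) _.
    rewrite leq_mul2r leq_mul2r; apply/orP; right; apply/orP; right.
    apply/leP/INR_le; rewrite -multE mult_INR; move: TA Lt; rewrite !S_INR /=; lra.
  rewrite -ltnS; apply/ltP/INR_lt; rewrite S_INR; apply: Rle_lt_trans ltm.
  rewrite INR_expn [INR 2]/2 -Rpower2_INR -multE mult_INR.
  by apply: Rle_Rpower => /=; lra.
have [c [c_sym cP]] := good_partition nV mC.
exists c; split=> // I; rewrite sqrtA.
(* For empty [I] the value of [log2 0] is multiplied by 0 and both bounds are 1. *)
have [I0|I0] := posnP #|I|.
  apply: Rle_trans (cP I 2 0%N _ _) _ => /=; try lra.
  rewrite I0 muln0 /= Rmult_0_l sqrt_0 Rmult_0_r Rpower_O; lra.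
have [lam [B [lam1 [lamB bound]]]] := branching_parameters (ltn0Sn T) I0.
apply: Rle_trans (cP I lam B lam1 lamB) (Rle_trans _ _ _ bound _).
apply: Rle_Rpower; first lra.
apply: Rmult_le_compat_r; first exact: sqrt_pos.
by apply: Rmult_le_compat_l; [lra|apply: sqrt_le_1_alt].
Qed.
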